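(* Let $b$ be a complex-valued function on graphs with non-empty vertex set and let $f_b$ be the associated graph polynomial, $f_b(G,x)=\sum_{k=1}^{|V(G)|}a_k(G)x^k$ with $a_k(G)=\sum_{\{S_1,\dots,S_k\}}b(G[S_1])\cdots b(G[S_k])$ summed over partitions of $V(G)$ into exactly $k$ non-empty sets, and $f_b(\emptyset,x)=1$. Then $f_b$ is multiplicative if and only if $b(H)=0$ for every non-connected graph $H$ (with non-empty vertex set).
   Context: All graphs are finite simple graphs. A graph polynomial $f$ is multiplicative if $f(G_1\uplus G_2,x)=f(G_1,x)f(G_2,x)$ for all graphs $G_1,G_2$, where $\uplus$ is disjoint union. $G[S]$ is the induced subgraph on $S$. (Every graph polynomial of exponential type is of the form $f_b$.) *)

(* Defs.v *)
From HB Require Import structures.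
From mathcomp Require Import all_boot all_order all_algebra.
From mathcomp Require Import complex reals.

Set Implicit Arguments.
Unset Strict Implicit.
Unset Printing Implicit Defensive.

Import GRing.Theory.
Local Open Scope ring_scope.

Record sgraph := SGraph {
  vertex :> finType;
  edge : rel vertex;
  edge_sym : symmetric edge;
  edge_irrefl : irreflexive edge }.

Definition isomorphic (G H : sgraph) : Prop :=
  exists2 h : G -> H, bijective h & forall x y, edge (h x) (h y) = edge x y.

Definition connected_graph (G : sgraph) : Prop :=
  (0 < #|G|)%N /\ forall x y : G, connect (@edge G) x y.

Section Induced.
Variables (G : sgraph) (S : {set G}).

Definition induced_edge : rel {x : G | x \in S} :=
  fun x y => edge (val x) (val y).

Lemma induced_sym : symmetric induced_edge.
Proof. by move=> x y; rewrite /induced_edge edge_sym. Qed.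

Lemma induced_irrefl : irreflexive induced_edge.
Proof. by move=> x; rewrite /induced_edge edge_irrefl. Qed.

Definition induced : sgraph := SGraph induced_sym induced_irrefl.
End Induced.

Section DisjointUnion.
Variables G1 G2 : sgraph.

Definition union_edge : rel (G1 + G2)%type := fun u v =>
  match u, v with
  | inl x, inl y => edge x y
  | inr x, inr y => edge x y
  | _, _ => false
  end.

Lemma union_sym : symmetric union_edge.
Proof. by move=> [x|x] [y|y] //=; rewrite edge_sym. Qed.

Lemma union_irrefl : irreflexive union_edge.
Proof. by move=> [x|x] /=; rewrite edge_irrefl. Qed.

Definition disjoint_union : sgraph := SGraph union_sym union_irrefl.
End DisjointUnion.

(* A function on (isomorphism classes of) graphs with non-empty vertex set is  *)
(* represented by a total function on [sgraph] that is isomorphism-invariant   *)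
(* on non-empty graphs; its value on empty graphs is arbitrary and is never    *)
(* used below, since the blocks of a [partition] are non-empty.                *)
Definition iso_invariant (T : Type) (b : sgraph -> T) : Prop :=
  forall G H : sgraph, (0 < #|G|)%N -> isomorphic G H -> b G = b H.

Definition multiplicative (C : comNzRingType) (f : sgraph -> {poly C}) : Prop :=
  forall G1 G2 : sgraph, f (disjoint_union G1 G2) = f G1 * f G2.

Definition exp_coef (C : comNzRingType) (b : sgraph -> C) (G : sgraph)
    (k : nat) : C :=
  \sum_(P : {set {set G}} | partition P [set: G] && (#|P| == k))
    \prod_(S in P) b (induced S).

Definition exp_poly (C : comNzRingType) (b : sgraph -> C) (G : sgraph) :
    {poly C} :=
  if #|G| == 0%N then 1
  else \sum_(1 <= k < #|G|.+1) exp_coef b G k *: 'X^k.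

(* Main.v *)
From Pilot Require Import Defs.
From HB Require Import structures.
From mathcomp Require Import all_boot all_order all_algebra.
From mathcomp Require Import complex reals.

(** [f_b(G)] is the sum over all partitions of the vertex set of the product of
    the weights [b(G[S]) x] of the blocks [S].  For a disjoint union
    [G1 + G2], the partitions in which every block lies on one side contribute
    exactly [f_b(G1) f_b(G2)], and every other partition has a block inducing a
    non-connected graph, so its contribution vanishes when [b] kills
    non-connected graphs.  Conversely, a non-connected [H] is isomorphic to a
    disjoint union of two non-empty graphs, and [b H] is the coefficient of [x]
    in [f_b(H)], whereas a product of two polynomials without constant term has
    no linear term. *)

Set Implicit Arguments.
Unset Strict Implicit.
Unset Printing Implicit Defensive.

Import GRing.Theory.
(* Undoes the shadowing of [Defs.multiplicative] by [GRing.Theory]. *)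
Import Pilot.Defs.
Local Open Scope ring_scope.

(** * Sums over set partitions *)

Section PartitionSum.
Variable T : finType.
Implicit Types (P Q : {set {set T}}) (A B D S : {set T}).

Lemma partitionU P Q A B : [disjoint A & B] ->
  partition P A -> partition Q B -> partition (P :|: Q) (A :|: B).
Proof.
move=> dAB /and3P[/eqP cP tP nP] /and3P[/eqP cQ tQ nQ].
rewrite /partition inE negb_or nP nQ trivIsetU ?cP ?cQ // !andbT.
by rewrite /cover bigcup_setU -/(cover P) -/(cover Q) cP cQ.
Qed.

(** [P ::&: A] keeps the blocks contained in [A]. They still cover [A], since a block through a
    point of [A] cannot lie in [B]. *)
Lemma partition_ssetI P A B : [disjoint A & B] ->
    partition P (A :|: B) ->
    (forall S, S \in P -> (S \subset A) || (S \subset B)) ->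
  partition (P ::&: A) A.
Proof.
move=> dAB /and3P[/eqP cP tP nP] split; apply/and3P; split.
- rewrite eqEsubset (subset_trans (cover_setI _ _)) ?subsetIr //=.
  apply/subsetP => x xA; have: x \in cover P by rewrite cP inE xA.
  case/bigcupP=> S SP xS; apply/bigcupP; exists S => //; rewrite inE SP /=.
  case/orP: (split S SP) => // /subsetP/(_ x xS) xB.
  by rewrite (disjointFr dAB xA) in xB.
- exact: trivIsetI.
- by rewrite inE (negPf nP).
Qed.

Lemma partition_setUI P Q A B : [disjoint A & B] ->
  partition P A -> partition Q B -> (P :|: Q) ::&: A = P.
Proof.
move=> dAB pP pQ; apply/setP => S; rewrite !inE.
have [SP|_] /= := boolP (S \in P); first exact: partitionS SP.
apply/andP => -[SQ SA]; case/negP: (partition_neq0 pQ SQ).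
by rewrite -subset0 -(disjoint_setI0 dAB) subsetI SA (partitionS pQ).
Qed.

Lemma leq_card_partition P D :
  partition P D -> (#|P| <= #|D|)%N.
Proof.
move=> pP; rewrite (card_partition pP) -sum1_card; apply: leq_sum => S SP.
by rewrite card_gt0 (partition_neq0 pP).
Qed.

Definition partition_sum (C : comNzRingType) (w : {set T} -> C) D : C :=
  \sum_(P : {set {set T}} | partition P D) \prod_(S in P) w S.

Lemma partition_sumU (C : comNzRingType) (w : {set T} -> C) A B :
    [disjoint A & B] ->
    (forall S, ~~ (S \subset A) -> ~~ (S \subset B) -> w S = 0) ->
  partition_sum w (A :|: B) = partition_sum w A * partition_sum w B.
Proof.
move=> dAB w0; have dBA : [disjoint B & A] by rewrite disjoint_sym.
rewrite /partition_sum big_distrlr pair_big /=.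
pose split P := [forall (S | S \in P), (S \subset A) || (S \subset B)].
rewrite (bigID split) /= [X in _ + X]big1 ?addr0; last first.
  move=> P /andP[_ /forall_inPn[S SP]]; rewrite negb_or => /andP[nA nB].
  by rewrite (bigD1 S) //= w0 // mul0r.
(* Partitions whose blocks each lie on one side correspond to pairs of partitions: take the union
   one way, sort the blocks by side the other way. *)
rewrite (reindex_onto (fun p : {set {set T}} * {set {set T}} => p.1 :|: p.2)
                      (fun P => (P ::&: A, P ::&: B))) /=; last first.
  move=> P /andP[_ /forall_inP sP]; apply/setP => S; rewrite !inE -andb_orr.
  by have [/sP->|] := boolP (S \in P).
apply: etrans (_ : \sum_(p : {set {set T}} * {set {set T}}
    | partition p.1 A && partition p.2 B) \prod_(S in p.1 :|: p.2) w S = _);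
  last first.
  (* The product splits because [P] and [Q] share no block: a common block would lie in the empty
     set [A :&: B], yet blocks are non-empty. *)
  apply: eq_bigr => -[P Q] /= /andP[pP pQ]; rewrite -bigU.
    by apply: eq_bigl => S; rewrite inE.
  rewrite -setI_eq0; apply/eqP/setP => S; rewrite !inE; apply/andP => -[SP SQ].
  case/negP: (partition_neq0 pQ SQ); rewrite -subset0 -(disjoint_setI0 dAB).
  by rewrite subsetI (partitionS pP) ?(partitionS pQ).
apply: eq_bigl => -[P Q] /=.
apply/idP/idP => [/andP[/andP[pPQ /forall_inP sP] /eqP[EP EQ]]|/andP[pP pQ]];
  apply/andP; split.
- by rewrite -EP; apply: partition_ssetI dAB pPQ sP.
- rewrite -EQ; apply: partition_ssetI dBA _ _; first by rewrite [B :|: A]setUC.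
  by move=> S /sP; rewrite orbC.
- rewrite partitionU //; apply/forall_inP => S; rewrite inE.
  by case/orP=> [/(partitionS pP)|/(partitionS pQ)] ->; rewrite ?orbT.
- by rewrite (partition_setUI dAB pP pQ) setUC (partition_setUI dBA pQ pP).
Qed.

End PartitionSum.

Lemma card_induced (G : sgraph) (S : {set G}) : #|induced S| = #|S|.
Proof. by rewrite card_sig; apply: eq_card. Qed.

(** No edge crosses sides, so the left vertices are closed under adjacency and no path leads from
    [x] to [y]. *)
Lemma mixed_not_connected (G1 G2 : sgraph) (S : {set disjoint_union G1 G2})
    (x : G1) (y : G2) :
  inl x \in S -> inr y \in S -> ~ connected_graph (induced S).
Proof.
move=> xS yS [_ /(_ (exist _ (inl x) xS) (exist _ (inr y) yS)) cxy].
pose left : {pred induced S} :=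
  fun u => if val u is inl _ then true else false.
have cl : closed (@edge (induced S)) left by move=> [[u|u] uS] [[v|v] vS].
by have := closed_connect cl cxy.
Qed.

(** * The polynomial as a partition sum *)

Section GraphPolynomial.
Variables (C : comNzRingType) (b : sgraph -> C).

(** One factor ['X] per block makes the product over [P] carry the power [#|P|], so the grading by
    number of blocks needs no separate sum. *)
Definition block_weight (G : sgraph) (S : {set G}) : {poly C} :=
  b (induced S) *: 'X.

Lemma exp_polyE (G : sgraph) :
  exp_poly b G = partition_sum (@block_weight G) [set: G].
Proof.
rewrite /exp_poly /partition_sum; case: eqP => [G0|/eqP G0].
  have -> : [set: G] = set0 by apply/eqP; rewrite -cards_eq0 cardsT G0.
  rewrite (eq_bigl _ _ (@partition_set0 _)) big_pred1_eq.
  by rewrite big_set0.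
under eq_bigr do rewrite /exp_coef scaler_suml.
rewrite (exchange_big_dep (fun P : {set {set G}} => partition P [set: G])) /=;
  last by move=> k P _ /andP[].
apply: eq_bigr => P pP; rewrite pP /= /block_weight scaler_prodr.
under eq_bigl do rewrite eq_sym.
(* Only [k = #|P|] survives. It is in range: at most [#|G|] because blocks are non-empty, and
   positive because [G] is. *)
rewrite big_nat1_eq ltnS -cardsT leq_card_partition // andbT.
case: posnP => // /eqP; rewrite cards_eq0 => /eqP P0; case/negP: G0.
by rewrite -cardsT -(cover_partition pP) P0 /cover big_set0 cards0.
Qed.

Lemma coef0_exp_poly (G : sgraph) : (0 < #|G|)%N -> (exp_poly b G)`_0 = 0.
Proof.
rewrite lt0n /exp_poly => /negPf ->; rewrite coef_sum big_nat big1 // => k.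
by case: k => // k _; rewrite coefZ coefXn mulr0.
Qed.

Lemma coef1_exp_poly (G : sgraph) :
  (0 < #|G|)%N -> (exp_poly b G)`_1 = b (induced [set: G]).
Proof.
move=> G0; rewrite /exp_poly eqn0Ngt G0 /= coef_sum.
under eq_bigr => k _ do
  rewrite coefZ coefXn mulr_natr mulrb eq_sym.
rewrite -big_mkcond big_nat1_eq !ltnS G0 /= /exp_coef.
rewrite (big_pred1 [set [set: G]]) ?big_set1 // => P.
apply/andP/eqP => [[pP /cards1P[S EP]]|->].
  by rewrite -(cover_partition pP) EP cover1.
rewrite cards1 /partition cover1 trivIset1 inE !eqxx eq_sym -card_gt0.
by rewrite cardsT.
Qed.

Hypothesis hb : iso_invariant b.

Lemma b_induced_setT (G : sgraph) :
  (0 < #|G|)%N -> b (induced [set: G]) = b G.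
Proof.
move=> G0; apply/esym/hb => //.
exists (fun x => exist _ x (in_setT x)) => //.
exists val => [|[x xT]] //; exact: val_inj.
Qed.

Lemma b_induced_imset (G H : sgraph) (h : G -> H) (S : {set G}) :
    injective h -> (forall x y, edge (h x) (h y) = edge x y) -> S != set0 ->
  b (induced (h @: S)) = b (induced S).
Proof.
move=> injh edgeh /set0Pn[x0 x0S]; apply/esym/hb.
  by apply/card_gt0P; exists (exist _ x0 x0S).
exists (fun x : {x | x \in S} => exist _ (h (val x)) (imset_f h (valP x)));
  last by move=> x y; apply: edgeh.
apply: inj_card_bij => [x y [/injh/val_inj]//|].
by rewrite !card_induced card_imset.
Qed.

(** Moves the sum into an ambient graph, so that the polynomials of both summands become sums over
    subsets of one vertex type, as [partition_sumU] requires. *)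
Lemma exp_poly_embed (G H : sgraph) (h : G -> H) :
    injective h -> (forall x y, edge (h x) (h y) = edge x y) ->
  exp_poly b G = partition_sum (@block_weight H) (h @: [set: G]).
Proof.
move=> injh edgeh; rewrite exp_polyE /partition_sum.
have injH : injective (fun S : {set G} => h @: S) by apply: imset_inj.
(* Preimage inverts image here because every block of [Q] lies in the range of [h]. *)
rewrite [RHS](reindex_onto (fun P : {set {set G}} => [set h @: (S : {set G}) | S in P])
  (fun Q : {set {set H}} => [set h @^-1: (S : {set H}) | S in Q])) /=; last first.
  move=> Q pQ; rewrite -imset_comp -[RHS]imset_id.
  apply: eq_in_imset => S SQ /=; apply/setP => y.
  apply/imsetP/idP => [[x]|yS]; first by rewrite inE => ? ->.
  have /imsetP[x _ Ey] := subsetP (partitionS pQ SQ) y yS.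
  by exists x; rewrite // inE -Ey.
apply: eq_big => P.
  rewrite (imset_partition P [set: G] injh) -imset_comp.
  rewrite (_ : _ == P) ?andbT //; apply/eqP; rewrite -[RHS]imset_id.
  apply: eq_imset => S /=; apply/setP => x.
  by rewrite inE mem_imset.
move=> pP; rewrite big_imset /=; last by move=> S S' _ _; apply: injH.
apply: eq_bigr => S SP; rewrite /block_weight b_induced_imset //.
exact: partition_neq0 pP SP.
Qed.

Lemma exp_poly_multiplicative :
  (forall H : sgraph, (0 < #|H|)%N -> ~ connected_graph H -> b H = 0) ->
  multiplicative (exp_poly b).
Proof.
move=> b0 G1 G2; set G := disjoint_union G1 G2.
pose l (x : G1) : G := inl x; pose r (y : G2) : G := inr y.
rewrite (@exp_poly_embed G1 G l) ?(@exp_poly_embed G2 G r) //;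
  try by move=> ? ? [].
rewrite exp_polyE -partition_sumU.
- congr partition_sum; apply/setP => -[x|y]; rewrite !inE; apply/esym/orP.
    by left; apply/imsetP; exists x.
  by right; apply/imsetP; exists y.
- rewrite -setI_eq0; apply/eqP/setP => u; rewrite !inE.
  by apply/andP => -[/imsetP[x _ ->] /imsetP[]].
(* A vertex outside the left copy is a right one and vice versa, so [S] meets both sides. *)
move=> S /subsetPn[u uS nu] /subsetPn[v vS nv].
case: u uS nu => [x _ /imsetP[]|y yS _]; first by exists x.
case: v vS nv => [x xS _|y' _ /imsetP[]]; last by exists y'.
rewrite /block_weight b0 ?scale0r //; last exact: mixed_not_connected xS yS.
by rewrite card_induced card_gt0; apply/set0Pn; exists (inl x).
Qed.

Lemma b_disjoint_union (G1 G2 : sgraph) : multiplicative (exp_poly b) ->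
  (0 < #|G1|)%N -> (0 < #|G2|)%N -> b (disjoint_union G1 G2) = 0.
Proof.
move=> mult n1 n2; have n12 : (0 < #|disjoint_union G1 G2|)%N.
  by rewrite card_sum addn_gt0 n1.
rewrite -b_induced_setT // -coef1_exp_poly // mult coefM.
by rewrite big_ord_recl big_ord1 !coef0_exp_poly ?mul0r ?mulr0 ?addr0.
Qed.

End GraphPolynomial.

(** * Splitting a non-connected graph *)

Lemma isomorphic_disjoint_union (H : sgraph) (A : {set H}) :
    closed (@edge H) A ->
  isomorphic (disjoint_union (induced A) (induced (~: A))) H.
Proof.
move=> clA; pose h (u : disjoint_union (induced A) (induced (~: A))) : H :=
  match u with inl x => val x | inr y => val y end.
have hin u : (h u \in A) = if u is inl _ then true else false.
  by case: u => -[x xA] /=; rewrite ?xA //; move: xA; rewrite inE => /negPf.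
exists h; last first.
  move=> u v; have := @clA (h u) (h v); rewrite !hin.
  by case: u v => [u|u] [v|v] //= clu; apply/negbTE/negP => /clu.
apply: inj_card_bij => [u v E|].
  have := congr1 (fun z => z \in A) E; rewrite !hin; move: E.
  by case: u v => [u|u] [v|v] //= /val_inj ->.
by rewrite card_sum !card_induced cardsC.
Qed.

Lemma not_connected_closed (H : sgraph) : (0 < #|H|)%N -> ~ connected_graph H ->
  exists A : {set H}, [/\ closed (@edge H) A, A != set0 & ~: A != set0].
Proof.
move=> H0 nconn.
have [/forallP all_conn|/forallPn[x /forallPn[y nxy]]] :=
    boolP [forall x, forall y, connect (@edge H) x y].
  by case: nconn; split=> // x y; apply/forallP: y.
(* The component of [x] contains [x] and misses [y]. *)
exists [set z | connect (@edge H) x z]; split.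
- move=> u v uv; rewrite !inE; apply: connect_closed uv.
  exact: sym_connect_sym (@edge_sym H).
- by apply/set0Pn; exists x; rewrite inE.
- by apply/set0Pn; exists y; rewrite !inE.
Qed.

Theorem theorem5p3 (R : realType) (b : sgraph -> R[i]%C)
    (hb : iso_invariant b) :
  multiplicative (exp_poly b) <->
  (forall H : sgraph, (0 < #|H|)%N -> ~ connected_graph H -> b H = 0%R).
Proof.
split=> [mult H H0 nconn|]; last exact: exp_poly_multiplicative.
have [A [clA A0 cA0]] := not_connected_closed H0 nconn.
have gt0 (B : {set H}) : B != set0 -> (0 < #|induced B|)%N.
  by rewrite card_induced card_gt0.
rewrite -(hb _ _ _ (isomorphic_disjoint_union clA)).
  by rewrite b_disjoint_union ?gt0.
by rewrite card_sum addn_gt0 gt0.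
Qed.
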